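(* Let $s<t$ be relatively prime positive integers and $n$ a positive integer. Let $M\Delta_n$ be the largest (under partition-wise containment $\prec$) delta-set containing exactly $n$ elements. Then for any $(s,t)$-closed beta-set $\beta$ containing $n$ elements, $\beta\prec\overline{M\Delta_n+s}$.
   Context: A beta-set is a finite set of positive integers, written in decreasing order $\beta=\{\beta_1>\dots>\beta_n\}$; its associated partition is $P(\beta)=(\beta_1-(n-1),\dots,\beta_n)$. For partitions $P=(P_1,\dots,P_n)$, $Q=(Q_1,\dots,Q_m)$ write $P<Q$ if $n\le m$ and $P_i\le Q_i$ for all $i\le n$; for beta-sets $\beta\prec\gamma$ means $P(\beta)<P(\gamma)$. A beta-set $\beta$ is $(s,t)$-closed if for every $x\in\beta$: $x>s$ implies $x-s\in\beta$ and $x>t$ implies $x-t\in\beta$. The $(s,t)$-closure of a set $\beta$ of positive integers is $\overline{\beta}=\{x-as-bt : x\in\beta,\ a,b\ge0,\ x>as+bt\}$. A delta-set is a set $\overline{\{g\}}$ with $g$ a positive integer (its generator). For a set $\beta$ and positive integer $k$, $\beta+k=\{x+k:x\in\beta\}$. *)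

(* Defs.v *)
From mathcomp Require Import all_boot finmap zify.
Set Implicit Arguments. Unset Strict Implicit. Unset Printing Implicit Defensive.

Local Open Scope fset_scope.
Local Open Scope nat_scope.

Definition beta_set (beta : {fset nat}) : bool := 0 \notin beta.

Definition beta_seq (beta : {fset nat}) : seq nat := sort geq beta.

(* With 0-based indices the i-th part is beta_i - (n - 1 - i); for a beta-set of
   size n, beta_i >= n - i, so the truncated subtractions are exact and every
   part is positive. *)
Definition partition_of (beta : {fset nat}) : seq nat :=
  mkseq (fun i => nth 0 (beta_seq beta) i - (#|` beta| - i.+1)) #|` beta|.

Definition partition_le (P Q : seq nat) : Prop :=
  size P <= size Q /\ forall i, i < size P -> nth 0 P i <= nth 0 Q i.

Definition beta_le (beta gamma : {fset nat}) : Prop :=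
  partition_le (partition_of beta) (partition_of gamma).

Definition st_closed (s t : nat) (beta : {fset nat}) : Prop :=
  forall x, x \in beta ->
    (s < x -> x - s \in beta) /\ (t < x -> x - t \in beta).

(* The bounds a, b < x are harmless when s, t > 0, see st_closureP below. *)
Definition st_closure (s t : nat) (beta : {fset nat}) : {fset nat} :=
  \bigcup_(x <- beta)
    [fset (x - (a * s + b * t))%N | a in iota 0 x, b in iota 0 x
                                  & a * s + b * t < x].

Definition delta_set (s t : nat) (D : {fset nat}) : Prop :=
  exists2 g, 0 < g & D = st_closure s t [fset g].

Definition beta_shift (k : nat) (beta : {fset nat}) : {fset nat} :=
  [fset (x + k)%N | x in beta].

Definition is_MDelta (s t n : nat) (M : {fset nat}) : Prop :=
  [/\ delta_set s t M, #|` M| = n &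
      forall D, delta_set s t D -> #|` D| = n -> beta_le D M].

Lemma st_closureP (s t : nat) (beta : {fset nat}) (y : nat) :
  0 < s -> 0 < t ->
  reflect (exists x a b, [/\ x \in beta, a * s + b * t < x
                           & y = x - (a * s + b * t)])
          (y \in st_closure s t beta).
Proof.
move=> s0 t0; apply: (iffP (bigfcupP _ _ _ _)).
  case=> x /andP[xb _] /imfset2P[a /= _ [b /=]].
  rewrite inE => /andP[_ lt_x] ->.
  by exists x, a, b.
case=> x [a [b [xb lt_x ->]]]; exists x; first by rewrite xb.
apply/imfset2P; exists a; first by rewrite /= mem_iota; nia.
by exists b => //; rewrite inE /= mem_iota lt_x andbT; nia.
Qed.

Section Existence.
Variables (s t : nat).
Hypotheses (s0 : 0 < s) (t0 : 0 < t).

Let inS h := [exists a : 'I_h.+1, [exists b : 'I_h.+1, h == a * s + b * t]].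

Let inSP h : reflect (exists a b, h = a * s + b * t) (inS h).
Proof.
apply: (iffP existsP) => [[a /existsP[b /eqP ->]]|[a [b e]]]; first by exists a, b.
have ha : a < h.+1 by nia.
have hb : b < h.+1 by nia.
by exists (Ordinal ha); apply/existsP; exists (Ordinal hb); apply/eqP.
Qed.

Let gaps g := [seq g - h | h <- iota 0 g & inS h].

Let gaps_sorted g : sorted gtn (gaps g).
Proof.
rewrite /gaps; have : sorted ltn [seq h <- iota 0 g | inS h].
  by apply: sorted_filter; [exact: ltn_trans | exact: iota_ltn_sorted].
have : all (fun h => h < g) [seq h <- iota 0 g | inS h].
  by apply/allP => h; rewrite mem_filter mem_iota => /andP[_]; lia.
case: [seq h <- iota 0 g | inS h] => //= x l.
elim: l x => //= y l IH x /and3P[hx hy hl] /andP[xy p].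
by apply/andP; split; [lia | apply: IH => //; rewrite hy].
Qed.

Let mem_gaps g : st_closure s t [fset g] =i gaps g.
Proof.
move=> y; apply/st_closureP/mapP => //.
  case=> x [a [b [/fset1P -> lt_g ->]]]; exists (a * s + b * t) => //.
  by rewrite mem_filter mem_iota add0n lt_g /= andbT; apply/inSP; exists a, b.
case=> h; rewrite mem_filter mem_iota add0n => /and3P[/inSP[a [b ->]] _ lt_g] ->.
by exists g, a, b; rewrite fset11.
Qed.

Let gaps_uniq g : uniq (gaps g).
Proof.
apply: (@sorted_uniq _ gtn) (gaps_sorted g).
  by move=> x y z /=; lia.
by move=> x; rewrite /= ltnn.
Qed.

Let beta_seq_delta g : beta_seq (st_closure s t [fset g]) = gaps g.
Proof.
apply: (@sorted_eq _ geq).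
- by move=> x y z /=; lia.
- by move=> x y /=; lia.
- by apply: sort_sorted => x y /=; lia.
- by apply: sub_sorted (gaps_sorted g) => x y /=; lia.
- rewrite perm_sort; apply: uniq_perm; [exact: fset_uniq | exact: gaps_uniq|].
  exact: mem_gaps.
Qed.

Let N g := count inS (iota 0 g).

Let card_delta g : #|` st_closure s t [fset g]| = N g.
Proof.
by rewrite -(size_sort geq) -/(beta_seq _) beta_seq_delta size_map size_filter.
Qed.

Let NS g : N g.+1 = N g + inS g.
Proof. by rewrite /N -addn1 iotaD count_cat /= addn0. Qed.

Let N_ge k : k <= N (k * s).
Proof.
elim: k => // k IH; rewrite mulSn addnC.
have -> : N (k * s + s) = N (k * s) + count inS (iota (k * s) s).
  by rewrite /N iotaD count_cat add0n.
suff : 0 < count inS (iota (k * s) s) by lia.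
rewrite -has_count; apply/hasP; exists (k * s); first by rewrite mem_iota; lia.
by apply/inSP; exists k, 0; lia.
Qed.

Let N_mono g g' : g <= g' -> N g <= N g'.
Proof. by move=> le_gg'; rewrite -(subnKC le_gg') /N iotaD count_cat leq_addr. Qed.

Let N_ex n : exists g, N g == n.
Proof.
elim: n => [|n [g0 /eqP e0]]; first by exists 0.
have bd g : N g == n -> g <= n.+1 * s.
  move=> /eqP e; rewrite leqNgt; apply/negP => /ltnW /N_mono.
  by have := N_ge n.+1; lia.
have ex : exists g, N g == n by exists g0; rewrite e0.
case: (ex_maxnP ex bd) => g /eqP e mx; exists g.+1.
have : N g.+1 != n by apply/negP => /mx; lia.
by rewrite NS e; case: inS; rewrite ?addn0 ?addn1 // eqxx.
Qed.

Let eq_N_beta_le g g' : g <= g' -> N g = N g' ->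
  beta_le (st_closure s t [fset g]) (st_closure s t [fset g']).
Proof.
move=> le_gg' eN; split; first by rewrite !size_mkseq !card_delta eN.
move=> i; rewrite size_mkseq => lt_i.
have lt_i' : i < #|` st_closure s t [fset g']| by rewrite card_delta -eN -card_delta.
rewrite !nth_mkseq // !card_delta eN !beta_seq_delta; apply: leq_sub2r.
have eF : [seq h <- iota 0 g' | inS h] = [seq h <- iota 0 g | inS h].
  rewrite -(subnKC le_gg') iotaD filter_cat.
  suff /size0nil -> : size [seq h <- iota (0 + g) (g' - g) | inS h] = 0 by rewrite cats0.
  rewrite size_filter; move: eN.
  have -> : N g' = N g + count inS (iota (0 + g) (g' - g)).
    by rewrite -count_cat -iotaD subnKC.
  by move=> /eqP; rewrite -{1}[N g]addn0 eqn_add2l => /eqP <-.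
have lt_iN : i < size [seq h <- iota 0 g | inS h].
  by rewrite size_filter -/(N g) -card_delta.
by rewrite /gaps eF !(nth_map 0) // leq_sub2r.
Qed.

Lemma MDelta_exists (n : nat) : 0 < n -> exists M, is_MDelta s t n M.
Proof.
move=> n0.
have bd g : N g == n -> g <= n.+1 * s.
  move=> /eqP e; rewrite leqNgt; apply/negP => /ltnW /N_mono.
  by have := N_ge n.+1; lia.
case: (ex_maxnP (N_ex n) bd) => g /eqP e mx.
exists (st_closure s t [fset g]); split; last first.
- move=> _ [g' _ ->]; rewrite card_delta => e'.
  by apply: eq_N_beta_le; [apply: mx; apply/eqP | rewrite e].
- by rewrite card_delta.
- by exists g => //; case: (g) e => // e; move: n0; rewrite -e.
Qed.

End Existence.

Lemma delta_beta_set (s t : nat) (beta : {fset nat}) :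
  0 < s -> 0 < t -> beta_set (st_closure s t beta).
Proof. by move=> s0 t0; apply/st_closureP => // -[x [a [b [_]]]]; lia. Qed.

Lemma beta_seq_ge (beta : {fset nat}) (i : nat) :
  beta_set beta -> i < #|` beta| -> #|` beta| - i <= nth 0 (beta_seq beta) i.
Proof.
rewrite -(size_sort geq) -/(beta_seq beta) /beta_set => b0.
have : 0 \notin beta_seq beta by rewrite mem_sort.
have : sorted gtn (beta_seq beta).
  rewrite gtn_sorted_uniq_geq sort_uniq fset_uniq /=.
  by apply: sort_sorted => x y /=; lia.
elim: (beta_seq beta) i => //= x l IH i p.
rewrite inE negb_or => /andP[x0 l0].
have pl := path_sorted p.
case: i => [_|i]; last by rewrite ltnS subSS => /(IH i pl l0).
case: l p l0 IH pl => [|y l] //=; first by lia.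
move=> /andP[xy _] l0 IH pl; have := IH 0 pl l0 isT.
by rewrite /=; lia.
Qed.

Lemma beta_le_anti (beta gamma : {fset nat}) :
  beta_set beta -> beta_set gamma ->
  beta_le beta gamma -> beta_le gamma beta -> beta = gamma.
Proof.
move=> b0 g0 [] + h1 [] + h2; move: h1 h2; rewrite !size_mkseq => h1 h2 l1 l2.
have eC : #|` beta| = #|` gamma| by lia.
have eB : beta_seq beta = beta_seq gamma.
  apply: (@eq_from_nth _ 0); rewrite !size_sort // => i lt_i.
  have lt_i' : i < #|` gamma| by rewrite -eC.
  have := h1 i lt_i; have := h2 i lt_i'; rewrite !nth_mkseq // eC.
  have := beta_seq_ge b0 lt_i; have := beta_seq_ge g0 lt_i'; rewrite eC; lia.
by apply/fsetP => x; rewrite -(mem_sort geq) -/(beta_seq _) eB mem_sort.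
Qed.

Lemma MDelta_unique (s t n : nat) (M M' : {fset nat}) :
  0 < s -> 0 < t -> is_MDelta s t n M -> is_MDelta s t n M' -> M = M'.
Proof.
move=> s0 t0 [dM cM mM] [dM' cM' mM'].
apply: beta_le_anti; [| |exact: mM'|exact: mM].
- by case: dM => g _ ->; apply: delta_beta_set.
- by case: dM' => g _ ->; apply: delta_beta_set.
Qed.

(* Main.v *)
(** Let S be the semigroup generated by s and t, and N(u) the number of its
    elements below u.  By maximality [M] is the closure of {g} with g in S and
    N(g) = n, so the closure of [M + s] is {g + s - h : h in S, h < g + s}.
    Everything reduces to: if beta has more than i elements >= x and N(h) <= i,
    then x + h + N(g + s) <= g + s + n.

    For this, extend beta by all integers <= 0 and look at the p residues mod s
    met by beta in a window [y, y + s), with p < s.  Order the residues along the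
    cycle r -> r + t, starting at a missed one; the j-th residue met can only
    contain elements below y + jt, as subtracting t repeatedly leads to missed
    residues.  Hence the elements of beta that are >= x inject into the elements
    of S below pt - (x - y) through (j, k) |-> (p - j)t + ks, k counting from x
    upwards.  So h < pt - (x - y), and p bounds the number of elements of S in the
    window of length s of S opposite to [y, y + s).  Summing over windows down to
    0 bounds n below by values of N, and N(u + d) <= N(u) + d concludes. *)
Require Import Defs.
From mathcomp Require Import all_boot finmap.
From mathcomp Require Import zify.
Local Open Scope fset_scope.
Local Open Scope nat_scope.

(** * The semigroup generated by [s] and [t] *)

Definition in_semigroup (s t h : nat) : bool :=
  has (fun b => (b * t <= h) && (s %| h - b * t)) (iota 0 h.+1).

Definition semigroup_count (s t u : nat) : nat :=
  count (in_semigroup s t) (iota 0 u).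

Lemma in_semigroupP (s t h : nat) : 0 < t ->
  reflect (exists a b, h = a * s + b * t) (in_semigroup s t h).
Proof.
move=> t0; apply: (iffP hasP) => [[b _ /andP[le_bh /dvdnP[a e]]]|[a [b e]]].
  by exists a, b; rewrite -e subnK.
exists b; first by rewrite mem_iota; nia.
by rewrite e leq_addl addnK dvdn_mull.
Qed.

Lemma semigroup_countD (s t u k : nat) :
  semigroup_count s t (u + k) =
  semigroup_count s t u + count (in_semigroup s t) (iota u k).
Proof. by rewrite /semigroup_count iotaD count_cat. Qed.

Lemma semigroup_count_mono (s t u v : nat) :
  u <= v -> semigroup_count s t u <= semigroup_count s t v.
Proof. by move=> le_uv; rewrite -(subnKC le_uv) semigroup_countD leq_addr. Qed.

Lemma count_iota_le (a : pred nat) (m k : nat) : count a (iota m k) <= k.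
Proof. by rewrite -{2}(size_iota m k) count_size. Qed.

(** Below [p * t], an element [a * s + b * t] has [b < p], and within a window of length [s] the
    residue of [b * t] determines it. *)
Lemma semigroup_count_window (s t u p : nat) : 0 < t -> u + s <= p * t ->
  count (in_semigroup s t) (iota u s) <= p.
Proof.
move=> t0 le_up; rewrite -size_filter.
rewrite -(size_map (modn^~ s)).
rewrite -[leqRHS](size_iota 0) -[leqRHS](size_map (fun b => b * t %% s)).
apply: uniq_leq_size.
  rewrite map_inj_in_uniq ?filter_uniq ?iota_uniq // => h h'.
  rewrite !mem_filter !mem_iota => /andP[_ hh] /andP[_ hh'] /= /eqP e.
  wlog le_hh : h h' hh hh' e / h <= h' => [W|].
    case: (leqP h h') => [|/ltnW] le; first exact: W.
    by apply/esym/W => //; rewrite eq_sym.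
  move: e; rewrite eq_sym eqn_mod_dvd // => /dvdnP[[|k] e]; nia.
move=> _ /mapP[h + ->]; rewrite mem_filter mem_iota.
move=> /andP[/(in_semigroupP _ _ _ t0)[a [b e]] hh].
apply/mapP; exists b; first by rewrite mem_iota; nia.
by rewrite e modnMDl.
Qed.

Lemma muln_mod_inj (s t q q' : nat) : coprime s t -> q < s -> q' < s ->
  q * t = q' * t %[mod s] -> q = q'.
Proof.
move=> co_st; wlog le_qq : q q' / q <= q' => [W|] lt_q lt_q' /eqP e.
  case: (leqP q q') => [|/ltnW] le; first by apply: W => //; apply/eqP.
  by apply/esym/W => //; apply/eqP; rewrite eq_sym.
move: e; rewrite eq_sym eqn_mod_dvd ?leq_mul2r ?le_qq ?orbT // -mulnBl.
by rewrite Gauss_dvdl // => /dvdnP[[|k]]; nia.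
Qed.

(** * Windows of a set closed under subtracting [s] and [t] *)

Section ClosedPredicate.
Variables (s t : nat) (b : pred nat).
Hypotheses (s0 : 0 < s) (t0 : 0 < t) (co_st : coprime s t).
Hypotheses (bs : forall v, s <= v -> b v -> b (v - s)).
Hypotheses (bt : forall v, t <= v -> b v -> b (v - t)).

Lemma closed_modn (u v : nat) : b v -> u <= v -> u = v %[mod s] -> b u.
Proof.
move=> bv le_uv /esym/eqP; rewrite eqn_mod_dvd // => /dvdnP[k e].
have {e le_uv} e : v = u + k * s by rewrite -e subnKC.
elim: k v bv e => [|k IH] v bv e; first by rewrite -[u]addn0 -e.
by apply: (IH (v - s)); [apply: bs => //|]; nia.
Qed.

Section Window.
Variables (y w : nat).
Hypotheses (le_yw : y <= w) (lt_wy : w < y + s) (bw : ~~ b w).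

(* [rep l] is the element of the window [y, y + s) congruent to w + l * t. *)
Let rep l := y + (w - y + l * t) %% s.
Let occ l := b (rep l).
Let rank l := count occ (iota 0 l.+1).

Lemma rep_modn l : rep l = w + l * t %[mod s].
Proof. by rewrite /rep modnDmr addnA subnKC. Qed.

Lemma rep_inj : {in iota 0 s &, injective rep}.
Proof.
move=> l l'; rewrite !mem_iota !add0n => ls ls' /addnI/eqP.
by rewrite eqn_modDl => /eqP; apply: muln_mod_inj.
Qed.

Lemma perm_rep : perm_eq (map rep (iota 0 s)) (iota y s).
Proof.
have U : uniq (map rep (iota 0 s)) by rewrite map_inj_in_uniq ?iota_uniq //; exact: rep_inj.
apply: uniq_perm; rewrite ?iota_uniq //.
apply: (uniq_min_size U _ _).2; last by rewrite size_map !size_iota.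
by move=> _ /mapP[l _ ->]; rewrite mem_iota leq_addr ltn_add2l ltn_mod.
Qed.

(** Induction along the cycle. In the class of [w], an element [v >= y] would satisfy [v >= w] and
    force [b w]. In a later class, [v] makes the class occupied, so [rank] grows by one, while
    [v - t] is below [y] or lies in the previous class. *)
Lemma rank_bound l v : y <= v -> b v -> v = w + l * t %[mod s] ->
  v < y + rank l * t.
Proof.
elim: l v => [|l IH] v le_yv bv e.
  have/negP[] := bw; case: (leqP w v) => [le_wv|lt_vw].
    by apply: closed_modn le_wv _; rewrite // e mul0n addn0.
  move/eqP: e; rewrite mul0n addn0 eq_sym eqn_mod_dvd ?(ltnW lt_vw) //.
  by case/dvdnP=> [[|k]]; nia.
have le_rv : rep l.+1 <= v.
  rewrite leqNgt; apply/negP => lt_vr.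
  have /eqP : rep l.+1 = v %[mod s] by rewrite rep_modn.
  rewrite eqn_mod_dvd ?(ltnW lt_vr) //.
  have : rep l.+1 < y + s by rewrite ltn_add2l ltn_mod.
  by move=> h /dvdnP[[|k]]; nia.
have o : occ l.+1 by apply: (closed_modn _ v) => //; rewrite rep_modn.
have -> : rank l.+1 = (rank l).+1.
  by rewrite /rank -(addn1 l.+1) iotaD count_cat /= add0n o !addn0 addn1.
case: (ltnP v (y + t)) => [|le_ytv]; first by nia.
have tv : t <= v by lia.
suff : v - t < y + rank l * t by rewrite mulSn; lia.
apply: IH; [lia|exact: bt|].
apply/eqP; rewrite -(eqn_modDr t) subnK //; apply/eqP; rewrite e mulSn.
by congr (_ %% _); lia.
Qed.

Lemma count_above (X L : nat) (p := count b (iota y s)) : y <= X -> p < s ->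
  count b (iota X L) <= semigroup_count s t (p * t - (X - y)).
Proof.
move=> le_yX lt_ps.
have ep : p = count occ (iota 0 s).
  by rewrite /p -(permP perm_rep) count_map.
pose idx v := index (y + (v - y) %% s) (map rep (iota 0 s)).
have idxP v : idx v < s /\ rep (idx v) = y + (v - y) %% s.
  have v_in : y + (v - y) %% s \in map rep (iota 0 s).
    by rewrite (perm_mem perm_rep) mem_iota leq_addr ltn_add2l ltn_mod.
  have lt : idx v < s by rewrite -[X in _ < X](size_iota 0) -(size_map rep) index_mem.
  split=> //; rewrite -[RHS](nth_index 0 v_in) -/(idx v).
  by rewrite (nth_map 0) ?size_iota // nth_iota.
have idx_mod v : y <= v -> v = w + idx v * t %[mod s].
  by move=> le_yv; rewrite -rep_modn (idxP v).2 modnDmr subnKC.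
have rank_le l : l < s -> rank l <= p.
  by move=> ls; rewrite ep /rank -(subnKC ls) iotaD count_cat leq_addr.
have rank_lt l l' : l < l' -> occ l' -> rank l < rank l'.
  move=> ll o; rewrite /rank -addn1 -(addn1 l') iotaD count_cat /= add0n o addn0.
  by rewrite leq_add2r -(subnKC ll) iotaD count_cat leq_addr.
have occ_idx v : y <= v -> b v -> occ (idx v).
  move=> le_yv bv; apply: (closed_modn _ v) => //.
    by rewrite (idxP v).2; have := leq_mod (v - y) s; lia.
  by rewrite rep_modn -idx_mod.
pose f v := (p - rank (idx v)) * t + (v - X) %/ s * s.
rewrite -size_filter -(size_map f) /semigroup_count -size_filter.
apply: uniq_leq_size.
  rewrite map_inj_in_uniq ?filter_uniq ?iota_uniq // => v v'.
  rewrite !mem_filter !mem_iota => /andP[bv /andP[Xv _]] /andP[bv' /andP[Xv' _]].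
  have [yv yv'] : y <= v /\ y <= v' by split; apply: leq_trans le_yX _.
  rewrite /f => e.
  have [ls _] := idxP v; have [ls' _] := idxP v'.
  (* Modulo [s] only the multiple of [t] survives, and its factor is at most [p < s]. *)
  have er : p - rank (idx v) = p - rank (idx v').
    apply: (muln_mod_inj s t) => //; try exact: leq_ltn_trans (leq_subr _ _) lt_ps.
    by rewrite -[LHS](modnMDl ((v - X) %/ s)) addnC e addnC modnMDl.
  (* Ranks of occupied classes strictly increase along the cycle. *)
  have ei : idx v = idx v'.
    have := rank_le _ ls; have := rank_le _ ls'.
    have := rank_lt (idx v) (idx v')^~ (occ_idx _ yv' bv').
    have := rank_lt (idx v') (idx v)^~ (occ_idx _ yv bv).
    case: (ltngtP (idx v) (idx v')) => // _.
      by move=> _ /(_ isT); lia.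
    by move=> /(_ isT); lia.
  have em : (v - X) %% s = (v' - X) %% s.
    by apply/eqP; rewrite -(eqn_modDr X) !subnK // idx_mod // [v' %% s]idx_mod // ei.
  move: e; rewrite er => /addnI e.
  by rewrite -(subnK Xv) -(subnK Xv') (divn_eq (v - X) s) e em -divn_eq.
move=> _ /mapP[v + ->]; rewrite !mem_filter !mem_iota => /andP[bv /andP[Xv _]].
have yv := leq_trans le_yX Xv.
apply/andP; split.
  by apply/in_semigroupP => //; exists ((v - X) %/ s), (p - rank (idx v)); rewrite addnC.
(* The multiple of [s] in [f v] is at most [v - X], and [v - rank (idx v) * t < y]. *)
have := rank_bound _ _ yv bv (idx_mod _ yv).
have : rank (idx v) * t <= p * t by rewrite leq_mul2r rank_le ?orbT ?(idxP v).1.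
have := leq_divM (v - X) s; rewrite /f mulnBl.
move: (_ %/ s * s) (rank _ * t) (p * t) => k r q; lia.
Qed.

End Window.

(** A full window has [s] elements, which is trivially enough. Otherwise it misses some [w], and
    [count_above] forces [h < p * t - (X - y)] for its count [p]; this is what
    [semigroup_count_window] requires. *)
Lemma window_ge (X L h k : nat) : k.+1 * s <= X ->
  semigroup_count s t h < count b (iota X L) ->
  count (in_semigroup s t) (iota (h.+1 + k * s) s) <=
  count b (iota (X - k.+1 * s) s).
Proof.
move=> le_kX lt_h; set y := X - _.
case: (ltnP (count b (iota y s)) s) => [lt_ps|]; last first.
  by apply: leq_trans; apply: count_iota_le.
have /allPn[w] : ~~ all b (iota y s) by rewrite all_count size_iota neq_ltn lt_ps.
rewrite mem_iota => /andP[le_yw lt_wy] bw.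
have yX : y <= X by rewrite leq_subr.
have := count_above _ _ le_yw lt_wy bw X L yX lt_ps.
move/(leq_trans lt_h) => lt; apply: semigroup_count_window => //.
have : h < count b (iota y s) * t - (X - y).
  by rewrite ltnNge; apply/negP => /(semigroup_count_mono s t); lia.
by rewrite /y; move: le_kX; rewrite mulSn; lia.
Qed.

Lemma windows_ge (X L h k : nat) : k * s <= X ->
  semigroup_count s t h < count b (iota X L) ->
  count (in_semigroup s t) (iota h.+1 (k * s)) <=
  count b (iota (X - k * s) (k * s)).
Proof.
move=> + lt_h; elim: k => [|k IH] // le_kX.
have le_kX' : k * s <= X by move: le_kX; rewrite mulSn; lia.
have := IH le_kX'; have := window_ge _ _ _ _ le_kX lt_h.
rewrite !mulSn [in X in _ -> _ -> X <= _]addnC !iotaD !count_cat.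
have -> : X - (s + k * s) + s = X - k * s by move: le_kX; rewrite mulSn; lia.
lia.
Qed.

End ClosedPredicate.

(** * Comparing parts by counting elements above a threshold *)

Lemma leq_nth_beta_seq (A : {fset nat}) (i y : nat) : i < #|` A| ->
  (y <= nth 0 (beta_seq A) i) = (i < count (leq y) A).
Proof.
rewrite -(size_sort geq) -/(beta_seq A).
have /permP/(_ (leq y)) <- : perm_eq (beta_seq A) A by rewrite perm_sort.
have : sorted geq (beta_seq A) by apply: sort_sorted => x z /=; lia.
elim: (beta_seq A) i => //= x l IH i p.
have lx : all (geq x) l by apply: order_path_min p => u v z /=; lia.
have pl := path_sorted p.
case: i => [_|i lt_i] /=.
  case: (leqP y x) => //= lt_xy; rewrite add0n; apply/esym/negbTE.
  rewrite -has_count; apply/hasPn => z /(allP lx) /=; lia.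
rewrite IH //; case: (leqP y x) => //= lt_xy; rewrite add0n.
have -> // : count (leq y) l = 0.
by apply/eqP; rewrite -leqn0 leqNgt -has_count; apply/hasPn => z /(allP lx) /=; lia.
Qed.

(** The reflection [h |-> g - h] maps the semigroup below [g] onto the delta-set; [0 < y] makes
    [h < g] automatic. *)
Lemma count_delta (s t g y : nat) : 0 < s -> 0 < t -> 0 < y ->
  count (leq y) (st_closure s t [fset g]) = semigroup_count s t (g.+1 - y).
Proof.
move=> s0 t0 y0.
have P : perm_eq (st_closure s t [fset g])
                 [seq g - h | h <- iota 0 g & in_semigroup s t h].
  apply: uniq_perm; first exact: fset_uniq.
    rewrite map_inj_in_uniq ?filter_uniq ?iota_uniq // => h h'.
    by rewrite !mem_filter !mem_iota; lia.
  move=> v; apply/st_closureP/mapP => //.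
    case=> x [a [b [/fset1P -> lt_g ->]]]; exists (a * s + b * t) => //.
    by rewrite mem_filter mem_iota add0n lt_g /= andbT; apply/in_semigroupP => //; exists a, b.
  case=> h; rewrite mem_filter mem_iota => /andP[/(in_semigroupP _ _ _ t0)[a [b ->]] lt_g] ->.
  by exists g, a, b; rewrite fset11.
rewrite (permP P) count_map count_filter /semigroup_count.
have -> : iota 0 g = iota 0 (g.+1 - y) ++ iota (g.+1 - y) (g - (g.+1 - y)).
  by rewrite -{2}[g.+1 - y]add0n -iotaD; congr iota; lia.
rewrite count_cat addnC (@eq_in_count _ _ pred0) ?count_pred0.
  by apply: eq_in_count => h; rewrite mem_iota /= => hh; rewrite andb_idl //; lia.
by move=> h; rewrite mem_iota /= => hh; apply/negbTE; rewrite negb_and -ltnNge; lia.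
Qed.

Lemma card_count_leq (A : {fset nat}) : beta_set A -> #|` A| = count (leq 1) A.
Proof.
move=> A0; apply/esym/eqP; rewrite -all_count; apply/allP => -[|] // zA.
by move: A0; rewrite /beta_set zA.
Qed.

Lemma card_delta (s t g : nat) : 0 < s -> 0 < t ->
  #|` st_closure s t [fset g]| = semigroup_count s t g.
Proof.
by move=> s0 t0; rewrite card_count_leq ?delta_beta_set // count_delta // subn1.
Qed.

Lemma count_leq_iota (A : {fset nat}) (x V : nat) :
  (forall v, v \in A -> v < V) ->
  count (leq x) A = count (mem A) (iota x (V - x)).
Proof.
move=> AV; rewrite -!size_filter; apply: perm_size; apply: uniq_perm.
- by rewrite filter_uniq ?fset_uniq.
- by rewrite filter_uniq ?iota_uniq.
move=> v; rewrite !mem_filter mem_iota /= andbC.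
by apply: andb_id2l => /AV; lia.
Qed.

Lemma closure_delta_shift (s t g : nat) : 0 < s -> 0 < t -> 0 < g ->
  st_closure s t (beta_shift s (st_closure s t [fset g])) =
  st_closure s t [fset (g + s)%N].
Proof.
move=> s0 t0 g0; apply/fsetP => y; apply/st_closureP/st_closureP => //.
  case=> _ [a [b [/imfsetP[/= v /st_closureP[]// z [a' [b' [/fset1P -> lt ->]]] ->] lt' ->]]].
  by exists (g + s), (a + a'), (b + b'); rewrite fset11; split=> //; nia.
case=> _ [a [b [/fset1P -> lt ->]]]; exists (g + s), a, b; split=> //.
apply/imfsetP; exists g => //=; apply/st_closureP => //.
by exists g, 0, 0; rewrite fset11 subn0.
Qed.

(** If [g] were outside the semigroup, [g.+1] would also generate a delta-set of [n] elements, with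
    a larger first part, against maximality. *)
Lemma MDelta_generator (s t n : nat) (M : {fset nat}) :
  0 < s -> 0 < t -> 0 < n -> is_MDelta s t n M ->
  exists g, [/\ 0 < g, M = st_closure s t [fset g],
    semigroup_count s t g = n & semigroup_count s t g.+1 = n.+1].
Proof.
move=> s0 t0 n0 [[g g0 eM] cM maxM]; exists g.
have cg : semigroup_count s t g = n by rewrite -cM eM card_delta.
split=> //; apply/eqP; rewrite -[g.+1]addn1 semigroup_countD cg /= addn0.
case: (boolP (in_semigroup s t g)) => [_|gS]; first by rewrite addn1.
have cg1 : semigroup_count s t g.+1 = n.
  by rewrite -[g.+1]addn1 semigroup_countD cg /= (negbTE gS) !addn0.
have [||_ ] := maxM (st_closure s t [fset g.+1]).
- by exists g.+1.
- by rewrite card_delta.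
rewrite eM size_mkseq => /(_ 0); rewrite card_delta // cg1 => /(_ n0).
rewrite !nth_mkseq ?card_delta ?cg ?cg1 //.
have : g < nth 0 (beta_seq (st_closure s t [fset g.+1])) 0.
  rewrite leq_nth_beta_seq ?card_delta ?cg1 // count_delta //.
  by rewrite subSnn /semigroup_count /= /in_semigroup /= dvdn0.
have : ~~ (g < nth 0 (beta_seq (st_closure s t [fset g])) 0).
  by rewrite leq_nth_beta_seq ?card_delta ?cg // count_delta // subnn.
(* Ensures that truncated subtraction does not make both first parts 0. *)
have : n <= g by rewrite -cg count_iota_le.
lia.
Qed.

(** * The inequality for closed beta-sets and the conclusion *)

Lemma closed_bound (s t g i x h : nat) (beta : {fset nat}) :
  0 < s -> 0 < t -> coprime s t -> beta_set beta -> st_closed s t beta ->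
  semigroup_count s t g = #|` beta| -> #|` beta| < semigroup_count s t g.+1 ->
  0 < x -> i < count (leq x) beta -> semigroup_count s t h <= i ->
  x + h + semigroup_count s t (g + s) <= g + s + #|` beta|.
Proof.
move=> s0 t0 co_st b0 b_cl eg lt_g x0 lt_i le_h.
(* beta together with all integers <= 0, translated by s to stay in nat. *)
pose b v := (v <= s) || (v - s \in beta).
have bs v : s <= v -> b v -> b (v - s).
  rewrite /b => sv; case: (leqP (v - s) s) => //= lt_vs.
  case: leqP => [|_] /=; first by lia.
  by case/b_cl => + _; apply.
have bt v : t <= v -> b v -> b (v - t).
  rewrite /b => tv; case: (leqP (v - t) s) => //= lt_vs.
  case: leqP => [|_] /=; first by lia.
  by case/b_cl => _; rewrite subnAC; apply; lia.
pose V := (\max_(v <- beta) v).+1.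
have bV v : v \in beta -> v < V by move=> vb; rewrite ltnS; apply: leq_bigmax_seq.
have cb y k : 0 < y -> count b (iota (y + s) k) = count (mem beta) (iota y k).
  move=> y0; rewrite [y + s]addnC iotaDl count_map; apply: eq_in_count => v.
  by rewrite mem_iota /= /b addKn => yv; case: leqP => //; lia.
have lt_xV : x < V.
  have : has (leq x) beta by rewrite has_count; lia.
  by case/hasP => v /bV /=; lia.
(* Dividing [x - 1] instead of [x] leaves [r + 1 >= 1] below the [K] windows. *)
pose K := x.-1 %/ s; pose r := x.-1 %% s.
have ex : x = K * s + r.+1 by have := divn_eq x.-1 s; rewrite -/K -/r; lia.
have lt_rs : r < s by rewrite ltn_mod.
pose X := x + s; pose L := V - x.
have lt_h : semigroup_count s t h < count b (iota X L).
  by rewrite cb // -count_leq_iota //; lia.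
have h1 : K * s <= X by lia.
have h2 : K.+1 * s <= X by rewrite mulSn; lia.
(* The windows going down from x: K of them lie above 0, and the last one has
   s - r elements <= 0, all of which belong to the extension of beta. *)
have := windows_ge s t b s0 t0 co_st bs bt X L h K h1 lt_h.
have := window_ge s t b s0 t0 co_st bs bt X L h K h2 lt_h.
have -> : X - K.+1 * s = r.+1 by rewrite mulSn; lia.
have -> : X - K * s = r.+1 + s by lia.
rewrite cb //.
have -> : iota r.+1 s = iota r.+1 (s - r) ++ iota (1 + s) r.
  by rewrite -{1}(subnK (ltnW lt_rs)) iotaD; congr (_ ++ iota _ _); lia.
rewrite count_cat cb //; have := count_iota_le b r.+1 (s - r).
have : #|` beta| = count (mem beta) (iota 1 r) +
   count (mem beta) (iota r.+1 (K * s)) + count (mem beta) (iota x L).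
  rewrite card_count_leq // (count_leq_iota _ _ V) // -!count_cat.
  have -> : V - 1 = r + K * s + L by lia.
  by rewrite !iotaD; congr (count _ (_ ++ iota _ _)); lia.
have ei : i < count (mem beta) (iota x L) by rewrite -count_leq_iota.
move: (count _ (iota 1 r)) => c1; move: (count _ (iota r.+1 (K * s))) => c2 en hw hQ hK.
have := semigroup_countD s t h.+1 (K * s).
have := semigroup_countD s t (h.+1 + K * s) s.
have := semigroup_countD s t h 1; rewrite addn1 /=.
set H := h.+1 + K * s in hQ * => e1 e2 e3.
(* At most [i + 1] semigroup elements are [<= h], matched by elements of [beta] from [x] up; those
   in the [K] windows are matched by [c2]. *)
have le_H : semigroup_count s t H <= #|` beta| by lia.
have le_Hg : H <= g.
  by rewrite leqNgt; apply/negP => /(semigroup_count_mono s t); lia.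
have : semigroup_count s t (g + s) <= semigroup_count s t (H + s) + (g - H).
  have -> : g + s = H + s + (g - H) by lia.
  by rewrite semigroup_countD leq_add2l count_iota_le.
(* The window after [H] adds at most [c1 + (s - r)]. *)
have : semigroup_count s t (H + s) + r <= #|` beta| + s by lia.
have : x + h = H + r by rewrite ex /H; lia.
move: (semigroup_count s t (g + s)) (semigroup_count s t (H + s)) => N1 N2.
move: H r #|` beta| le_Hg {e2 e3 le_H hQ eg lt_g en ex lt_rs hw cb h1 h2 hK} => H r n.
lia.
Qed.

Theorem theorem4p2 (s t n : nat) (s_gt0 : 0 < s) (s_lt_t : s < t)
    (co_st : coprime s t) (n_gt0 : 0 < n)
    (M : {fset nat}) (M_max : is_MDelta s t n M)
    (beta : {fset nat}) (beta_pos : beta_set beta)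
    (beta_closed : st_closed s t beta) (beta_card : #|` beta| = n) :
  beta_le beta (st_closure s t (beta_shift s M)).
Proof.
have t_gt0 : 0 < t by apply: leq_trans s_lt_t.
have [g [g_gt0 -> Ng Ng1]] := MDelta_generator s t n M s_gt0 t_gt0 n_gt0 M_max.
rewrite closure_delta_shift //.
have le_nm : n <= semigroup_count s t (g + s).
  by rewrite -Ng semigroup_count_mono ?leq_addr.
split; first by rewrite !size_mkseq card_delta // beta_card.
move=> i; rewrite size_mkseq beta_card => lt_in.
have lt_im := leq_trans lt_in le_nm.
rewrite !nth_mkseq ?card_delta ?beta_card //.
set x := nth 0 (beta_seq beta) i; set m := semigroup_count _ _ _ in le_nm lt_im *.
have lt_ix : i < count (leq x) beta by rewrite -leq_nth_beta_seq ?beta_card.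
have x_gt0 : 0 < x.
  by have := @beta_seq_ge beta i beta_pos; rewrite beta_card => /(_ lt_in); lia.
have bound h : semigroup_count s t h <= i -> x + h + m <= g + s + n.
  rewrite -beta_card; apply: closed_bound => //; rewrite beta_card //.
  by rewrite Ng1.
have := bound 0 isT; rewrite addn0 => le_xm.
(* The sets have [n] and [m] elements, so the subtracted staircases differ by [m - n]. *)
suff : x + m - n <= nth 0 (beta_seq (st_closure s t [fset (g + s)%N])) i by lia.
rewrite leq_nth_beta_seq ?card_delta // count_delta //; last by lia.
(* Here [h = g + s + 1 - (x + m - n)], exact by [le_xm], so [bound] fails by one. *)
rewrite ltnNge; apply/negP => /bound; lia.
Qed.
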